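(* Let $T$ be Thompson's group $T$ acting on the circle $S^1$. Suppose that $H\subset T$ admits elements $h_1$ and $h_2$ such that $\mathrm{Supp}(h_1)\cap \mathrm{Supp}(h_2)=\emptyset$. Then for $n\geq 2$ there is no set of elements $\{c_1,c_2,\ldots,c_n\}\subset T$ such that $\langle h^{c_1},h^{c_2},\ldots,h^{c_n}\rangle$ is a free group on $n$ generators (free of rank $n$) for all $h\in H$.
   Context: $S^1=\mathbb{R}/\mathbb{Z}$. Thompson's group $T$ is the group of orientation-preserving piecewise-linear homeomorphisms of $S^1$ that map the set $\mathbb{Z}[\frac12]/\mathbb{Z}$ of dyadic rational points to itself, are differentiable except at finitely many dyadic rational points, and whose slopes (where defined) are integer powers of $2$. It acts on $S^1$ on the left. For $g\in T$, $\mathrm{Supp}(g)=\{x\in S^1: g\cdot x\neq x\}$. Conjugation is $h^c:=chc^{-1}$. *)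

(* Defs.v *)
From HB Require Import structures.
From mathcomp Require Import all_boot all_order all_algebra.
From mathcomp Require Import all_classical all_reals all_analysis.
From mathcomp Require Import generic_quotient lra.

Set Implicit Arguments.
Unset Strict Implicit.
Unset Printing Implicit Defensive.

Import Order.TTheory GRing.Theory Num.Theory.
Import numFieldNormedType.Exports.

Local Open Scope classical_set_scope.
Local Open Scope ring_scope.
Local Open Scope quotient_scope.

Definition eqmodZ (R : realType) (x y : R) : bool := x - y \is a Num.int.

Lemma eqmodZ_refl (R : realType) : reflexive (@eqmodZ R).
Proof. by move=> x; rewrite /eqmodZ subrr rpred0. Qed.

Lemma eqmodZ_sym (R : realType) : symmetric (@eqmodZ R).
Proof. by move=> x y; rewrite /eqmodZ -opprB rpredN. Qed.

Lemma eqmodZ_trans (R : realType) : transitive (@eqmodZ R).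
Proof.
by move=> y x z xy yz; rewrite /eqmodZ -(subrK y x) -addrA; exact: rpredD.
Qed.

Canonical eqmodZ_equiv (R : realType) :=
  EquivRel (@eqmodZ R) (@eqmodZ_refl R) (@eqmodZ_sym R) (@eqmodZ_trans R).

Definition circle (R : realType) : Type :=
  quotient_topology {eq_quot (@eqmodZ R)}.

HB.instance Definition _ (R : realType) := Topological.on (circle R).

Definition circle_pi (R : realType) (x : R) : circle R :=
  (\pi_{eq_quot (@eqmodZ R)} x)%qT.

Lemma circle_piP (R : realType) (x y : R) :
  circle_pi x = circle_pi y <-> x - y \is a Num.int.
Proof. by split=> [/eqquotP|?]; [|apply/eqquotP]. Qed.

Lemma circle_pi_surj (R : realType) (p : circle R) : exists x, circle_pi x = p.
Proof. by exists (repr (p : {eq_quot _})); exact: reprK. Qed.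

Definition circle_dyadic (R : realType) : set (circle R) :=
  [set p | exists (m : int) (n : nat), p = circle_pi (m%:~R / 2 ^+ n)].

Definition homeomorphism (X : topologicalType) (g : X -> X) : Prop :=
  exists h : X -> X,
    [/\ cancel g h, cancel h g, continuous g & continuous h].

(* A homeomorphism of the circle preserves orientation when it is induced by
   such an [F]; two choices of [F] differ by an integer constant. *)
Definition increasing_lift (R : realType) (g : circle R -> circle R)
    (F : R -> R) : Prop :=
  [/\ continuous F, {homo F : x y / x < y}, forall x, F (x + 1) = F x + 1
    & forall x, g (circle_pi x) = circle_pi (F x)].

(* Piecewise linearity, the differentiability condition and the slope condition
   at once: off a finite set of dyadic points of the circle, the lift is locally
   affine, with slope an integer (possibly negative) power of 2.  If [F] happens
   to be differentiable at a point over [B], its slope there is the slope of the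
   neighbouring affine pieces. *)
Definition dyadic_piecewise_linear (R : realType) (F : R -> R) : Prop :=
  exists B : set (circle R),
    [/\ finite_set B, B `<=` @circle_dyadic R &
      forall x : R, ~ B (circle_pi x) ->
        exists k : int, \forall y \near x, F y = F x + 2 ^ k * (y - x)].

Definition is_thompsonT (R : realType) (g : circle R -> circle R) : Prop :=
  [/\ homeomorphism g, g @` @circle_dyadic R = @circle_dyadic R &
    exists2 F : R -> R, increasing_lift g F & dyadic_piecewise_linear F].

Section Closure.
Variable R : realType.
Implicit Types (f g : circle R -> circle R) (F G : R -> R).

Lemma is_thompsonT_id : is_thompsonT (@id (circle R)).
Proof.
split; first by exists id; split=> // x; exact: cvg_id.
  by rewrite image_id.
exists id; first by split=> // x; exact: cvg_id.
exists set0; split=> // x _; exists 0.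
by near=> y; rewrite expr0z mul1r addrC subrK.
Unshelve. all: by end_near. Qed.

Lemma is_thompsonT_comp f g :
  is_thompsonT f -> is_thompsonT g -> is_thompsonT (f \o g).
Proof.
move=> [[f' [fK f'K cf cf']] fD [F [cF iF F1 fF] [B [Bfin BD BF]]]].
move=> [[g' [gK g'K cg cg']] gD [G [cG iG G1 gG] [C [Cfin CD CG]]]].
split.
- exists (g' \o f'); split.
  + by move=> x /=; rewrite fK gK.
  + by move=> x /=; rewrite g'K f'K.
  + by move=> x; apply: continuous_comp; [exact: cg|exact: cf].
  + by move=> x; apply: continuous_comp; [exact: cf'|exact: cg'].
- by rewrite -image_comp gD fD.
exists (F \o G).
  split.
  + by move=> x; apply: continuous_comp; [exact: cG|exact: cF].
  + by move=> x y /iG/iF.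
  + by move=> x /=; rewrite G1 F1.
  + by move=> x /=; rewrite gG fF.
exists (C `|` g' @` B); split.
- by rewrite finite_setU; split=> //; exact: finite_image.
- move=> p [/CD//|[q /BD]]; rewrite -{1}gD => -[r rD <- <-].
  by rewrite gK.
move=> x /not_orP[nC nB].
have [k Hk] := CG _ nC.
have nBG : ~ B (circle_pi (G x)).
  by move=> BG; apply: nB; exists (circle_pi (G x)) => //; rewrite -gG gK.
have [l Hl] := BF _ nBG.
exists (l + k).
near=> y => /=.
have -> : F (G y) = F (G x) + 2 ^ l * (G y - G x).
  near: y; exact: (cG x _ Hl).
have -> : G y = G x + 2 ^ k * (y - x) by near: y.
by rewrite [G x + _]addrC addrK mulrA expfzDr// pnatr_eq0.
Unshelve. all: by end_near. Qed.

Lemma lift_int F (n : nat) x :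
  (forall x, F (x + 1) = F x + 1) -> F (x + n%:R) = F x + n%:R.
Proof.
move=> F1; elim: n => [|n IHn]; first by rewrite !addr0.
by rewrite -addn1 natrD !addrA F1 IHn.
Qed.

Lemma lift_surj F : continuous F -> (forall x, F (x + 1) = F x + 1) ->
  forall y, exists x, F x = y.
Proof.
move=> cF F1 y.
pose n := (Num.truncn `|y - F 0|).+1.
have yn : `|y - F 0| <= n%:R.
  by apply: ltW; rewrite /n truncnS_gt.
have ab : - n%:R <= n%:R :> R by rewrite ge0_cp.
have Fa : F (- n%:R) = F 0 - n%:R.
  by rewrite -[X in F X - _](addNr n%:R) lift_int// addrK.
have Fb : F n%:R = F 0 + n%:R by rewrite -{1}[n%:R]add0r lift_int.
have [] := @IVT _ F _ _ y ab.
- exact: continuous_subspaceT.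
- rewrite Fa Fb ge_min le_max; move: yn; rewrite ler_norml => /andP[h1 h2].
  by apply/andP; split; apply/orP; [left|right]; lra.
by move=> c _ <-; exists c.
Qed.

Lemma is_thompsonT_can g g' : cancel g g' -> cancel g' g ->
  is_thompsonT g -> is_thompsonT g'.
Proof.
move=> gK g'K [[h [hK h'K cg ch]] gD [F [cF iF F1 gF] [B [Bfin BD BF]]]].
have gh : g' = h by apply/funext => x; rewrite -{1}(h'K x) gK.
split.
- by exists g; split=> //; rewrite gh.
- rewrite -{1}gD; apply/seteqP; split=> [p [_ [q qD <-] <-]|p pD].
    by rewrite gK.
  by exists (g p); [exists p|rewrite gK].
have [G FK] : exists G, cancel G F.
  by have /choice[G ?] := lift_surj cF F1; exists G.
have mF : {mono F : x y / x <= y} by apply: le_mono.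
have GK : cancel F G by move=> x; apply: (inc_inj mF); rewrite FK.
have cG : continuous G.
  move=> y; rewrite -(FK y).
  have : {near F (G y), continuous G}.
    by apply: near_can_continuous; near=> z; [exact: GK|exact: cF].
  exact: nbhs_singleton.
exists G.
  split=> //.
  + by move=> x y; rewrite -{1}(FK x) -{1}(FK y) (leW_mono mF).
  + by move=> x; apply: (inc_inj mF); rewrite F1 !FK.
  + by move=> x; rewrite -{1}(FK x) -gF gK.
exists (g @` B); split; first exact: finite_image.
  by rewrite -[X in _ `<=` X]gD; exact: image_subset.
move=> y nB.
have nBG : ~ B (circle_pi (G y)).
  by move=> BG; apply: nB; exists (circle_pi (G y)) => //; rewrite gF FK.
have [k Hk] := BF _ nBG.
exists (- k).
near=> w.
have : F (G w) = F (G y) + 2 ^ k * (G w - G y).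
  near: w; exact: (cG y _ Hk).
rewrite !FK => wyE.
have wy : w - y = 2 ^ k * (G w - G y) by rewrite {1}wyE addrC addKr.
have k0 : 2 ^ k != 0 :> R by rewrite expfz_neq0// pnatr_eq0.
by rewrite wy mulrA -invr_expz mulVf// mul1r addrC subrK.
Unshelve. all: by end_near. Qed.

End Closure.

Record thompsonT (R : realType) := ThompsonT {
  thompsonT_fun :> circle R -> circle R;
  thompsonT_subproof : `[< is_thompsonT thompsonT_fun >]
}.

HB.instance Definition _ (R : realType) := [isSub for @thompsonT_fun R].
HB.instance Definition _ (R : realType) := gen_eqMixin (thompsonT R).
HB.instance Definition _ (R : realType) := gen_choiceMixin (thompsonT R).

Section ThompsonGroup.
Variable R : realType.
Implicit Types g h : thompsonT R.

Lemma thompsonTP g : is_thompsonT g.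
Proof. by have /asboolP := thompsonT_subproof g. Qed.

Lemma thompsonT_ext g h : (forall p, g p = h p) -> g = h.
Proof. by move=> gh; apply/val_inj/funext. Qed.

Definition thompsonT_one : thompsonT R :=
  ThompsonT (asboolT (@is_thompsonT_id R)).

Definition thompsonT_mul g h : thompsonT R :=
  ThompsonT (asboolT (is_thompsonT_comp (thompsonTP g) (thompsonTP h))).

Lemma thompsonT_inv_ex g :
  exists h : thompsonT R, cancel g h /\ cancel h g.
Proof.
have [[h [gK hK _ _]] _ _] := thompsonTP g.
by exists (ThompsonT (asboolT (is_thompsonT_can gK hK (thompsonTP g)))).
Qed.

Definition thompsonT_inv g : thompsonT R := sval (cid (thompsonT_inv_ex g)).

Lemma thompsonT_invK g :
  cancel g (thompsonT_inv g) /\ cancel (thompsonT_inv g) g.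
Proof. exact: svalP (cid (thompsonT_inv_ex g)). Qed.

Fact thompsonT_mulA : associative thompsonT_mul.
Proof. by move=> f g h; exact: thompsonT_ext. Qed.
Fact thompsonT_mul1g : left_id thompsonT_one thompsonT_mul.
Proof. by move=> f; exact: thompsonT_ext. Qed.
Fact thompsonT_mulg1 : right_id thompsonT_one thompsonT_mul.
Proof. by move=> f; exact: thompsonT_ext. Qed.
Fact thompsonT_mulVg : left_inverse thompsonT_one thompsonT_inv thompsonT_mul.
Proof.
by move=> f; apply: thompsonT_ext => p /=; rewrite (thompsonT_invK f).1.
Qed.
Fact thompsonT_mulgV : right_inverse thompsonT_one thompsonT_inv thompsonT_mul.
Proof.
by move=> f; apply: thompsonT_ext => p /=; rewrite (thompsonT_invK f).2.
Qed.

HB.instance Definition _ := isGroup.Build (thompsonT R)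
  thompsonT_mulA thompsonT_mul1g thompsonT_mulg1 thompsonT_mulVg thompsonT_mulgV.

Lemma thompsonT_mulE g h p : (g * h)%g p = g (h p). Proof. by []. Qed.
Lemma thompsonT_oneE (p : circle R) : (1%g : thompsonT R) p = p.
Proof. by []. Qed.

Definition supp g : set (circle R) := [set p | g p <> p].

End ThompsonGroup.

Definition generated (G : groupType) (A : set G) : set G :=
  smallest (fun S : set G => group_closed [in S]) A.

(* The letter [(x, true)] stands for the generator [x], and [(x, false)] for
   its inverse. *)
Section FreeGroup.
Variable X : choiceType.
Implicit Types (a b : X * bool) (u v w : seq (X * bool)).

Definition letter_inv a : X * bool := (a.1, ~~ a.2).

Definition reduced w : bool := sorted (fun a b => b != letter_inv a) w.

Record freeGroup := FreeGroup { word :> seq (X * bool); _ : reduced word }.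
HB.instance Definition _ := [isSub for word].
HB.instance Definition _ := [Choice of freeGroup by <:].

Definition red_cons a w :=
  if w is b :: w' then if b == letter_inv a then w' else a :: w else [:: a].

Definition word_mul u v := foldr red_cons v u.
Definition word_inv u := rev (map letter_inv u).

Lemma letter_invK : involutive letter_inv.
Proof. by case=> x b; rewrite /letter_inv /= negbK. Qed.

Lemma red_cons_reduced a w : reduced w -> reduced (red_cons a w).
Proof.
case: w => [//|b w] /= rw.
by case: ifPn => [_|ba]; [exact: path_sorted rw|rewrite /= ba].
Qed.

Lemma word_mul_reduced u v : reduced v -> reduced (word_mul u v).
Proof. by move=> rv; elim: u => //= a u; exact: red_cons_reduced. Qed.

Lemma red_consV a w : reduced w -> red_cons (letter_inv a) (red_cons a w) = w.
Proof.
case: w => [_|b w] /=; first by rewrite letter_invK eqxx.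
case: eqP => [->|_]; last by rewrite /= letter_invK eqxx.
by case: w => [//|c w] /= /andP[]; case: eqP.
Qed.

Lemma red_consK a w : reduced w -> red_cons a (red_cons (letter_inv a) w) = w.
Proof. by move=> rw; rewrite -{1}(letter_invK a) red_consV. Qed.

Lemma word_mul_cons a u v :
  reduced v -> word_mul (red_cons a u) v = red_cons a (word_mul u v).
Proof.
case: u => [//|b u] /= rv; case: eqP => [->|//].
by rewrite red_consK// word_mul_reduced.
Qed.

Lemma word_mulA u v w :
  reduced w -> word_mul u (word_mul v w) = word_mul (word_mul u v) w.
Proof. by move=> rw; elim: u => //= a u ->; rewrite word_mul_cons. Qed.

Lemma word_mulw1 u : reduced u -> word_mul u [::] = u.
Proof.
elim: u => //= a u IHu ru.
rewrite IHu; last exact: path_sorted ru.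
by case: u ru {IHu} => //= b u /andP[/negbTE ->].
Qed.

Lemma word_inv_reduced u : reduced u -> reduced (word_inv u).
Proof.
rewrite /reduced /word_inv rev_sorted sorted_map; apply: sub_sorted => a b /=.
by rewrite letter_invK eq_sym.
Qed.

Lemma word_invK : involutive word_inv.
Proof.
move=> u; rewrite /word_inv map_rev revK -map_comp -[RHS]map_id.
by apply: eq_map => a /=; rewrite letter_invK.
Qed.

Lemma word_mulVw u : reduced u -> word_mul (word_inv u) u = [::].
Proof.
have mulK v w : reduced w -> word_mul (word_inv v) (word_mul v w) = w.
  move=> rw; elim: v => //= a v IHv.
  rewrite /word_inv /= rev_cons /word_mul foldr_rcons.
  by rewrite red_consV ?word_mul_reduced.
by move=> ru; rewrite -{2}(word_mulw1 ru) mulK.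
Qed.

Lemma word_mulwV u : reduced u -> word_mul u (word_inv u) = [::].
Proof.
by move=> ru; rewrite -{1}(word_invK u) word_mulVw// word_inv_reduced.
Qed.

Implicit Types x y z : freeGroup.

Lemma freeGroupP x : reduced x. Proof. by case: x. Qed.

Definition free_one : freeGroup := @FreeGroup [::] isT.
Definition free_mul x y : freeGroup :=
  FreeGroup (word_mul_reduced x (freeGroupP y)).
Definition free_inv x : freeGroup := FreeGroup (word_inv_reduced (freeGroupP x)).

Fact free_mulA : associative free_mul.
Proof. by move=> x y z; apply: val_inj; exact/word_mulA/freeGroupP. Qed.
Fact free_mul1g : left_id free_one free_mul.
Proof. by move=> x; exact: val_inj. Qed.
Fact free_mulg1 : right_id free_one free_mul.
Proof. by move=> x; apply: val_inj; exact/word_mulw1/freeGroupP. Qed.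
Fact free_mulVg : left_inverse free_one free_inv free_mul.
Proof. by move=> x; apply: val_inj; exact/word_mulVw/freeGroupP. Qed.
Fact free_mulgV : right_inverse free_one free_inv free_mul.
Proof. by move=> x; apply: val_inj; exact/word_mulwV/freeGroupP. Qed.

HB.instance Definition _ := isGroup.Build freeGroup
  free_mulA free_mul1g free_mulg1 free_mulVg free_mulgV.

End FreeGroup.

(* [S] is intended to be a subgroup of [G]; it is asked to be isomorphic to the
   free group on [n] generators, without specifying a basis. *)
Definition free_of_rank (G : groupType) (n : nat) (S : set G) : Prop :=
  exists phi : {multiplicative freeGroup 'I_n -> G},
    injective phi /\ range phi = S.

(* Main.v *)
Require Import Defs.
From HB Require Import structures.
From mathcomp Require Import all_boot all_order all_algebra.
From mathcomp Require Import all_classical all_reals all_analysis.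
From mathcomp Require Import lra.

Set Implicit Arguments.
Unset Strict Implicit.
Unset Printing Implicit Defensive.

Import Order.TTheory GRing.Theory Num.Theory.
Import numFieldNormedType.Exports.

(** Write [f^c] for the conjugate [c * f * c^-1].  The theorem rests on two facts
    about [n >= 2] elements [g_1, ..., g_n] of T that generate a free group of
    rank [n]: [g_1] and [g_2] do not commute, and [g_1] and [g_2] have no common
    fixed point on the circle.

    Granting them, suppose that the [c_i] work for both [h1] and [h2].  A point
    [p] of the circle is not fixed by both [h1^(c_1)] and [h1^(c_2)], say it is
    moved by the first.  Then [c_1^-1 p] lies in the support of [h1], hence
    outside that of [h2], and [h2^(c_1)] fixes [p].  So every point is fixed by
    [h2^(c_1)] or by [h2^(c_2)]; these two have disjoint supports and commute,
    which contradicts the first fact.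

    The first fact ([generators_not_commute]) is seen in the abelianization.  Two
    commuting elements of a free group satisfy a nontrivial power relation
    ([free_commute_expg]), so their images in Q^n are linearly dependent, whereas
    the images of [n] generators span Q^n.

    The second fact ([commute_of_common_fixpoint]) is the Brin-Squier theorem
    that piecewise linear homeomorphisms of an interval generate no nonabelian
    free group, since a common fixed point [p] lets [g_1] and [g_2] act on the
    circle cut open at [p].  A commutator of elements of the group [<g_1, g_2>]
    has slope 1 on both sides of each common fixed point, so it is the identity
    near such points.  If a commutator [w] is the identity on [[a, t]], let [s]
    be the supremum of the orbit of [t]: it is a common fixed point, and some [k]
    in the group pushes [t] so close to [s] that [w] and [k * w * k^-1] have
    disjoint supports in [[a, s]].  Their commutator is then the identity on
    [[a, s]] and a bit further.  If it is trivial, [free_commute_expg] makes a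
    positive power of [w] equal to a power of [k * w * k^-1], and disjointness
    forces [w] itself to be the identity on [[a, s]].  In both cases some
    nontrivial commutator is the identity beyond [s].  By faithfulness the [t]
    reached in this way are bounded; but their supremum can be passed as well,
    because the germs of [g_1] and [g_2] there are affine ([brin_squier]). *)

(** * Generated subgroups and homomorphisms *)

Section GeneratedSubgroup.
Variable G : groupType.
Implicit Types (A : set G) (x y : G).
Local Open Scope group_scope.

Lemma generated_min A (S : set G) :
  S 1 -> (forall x y, S x -> S y -> S (x * y)) -> (forall x, S x -> S x^-1) ->
  (A `<=` S)%classic -> (generated A `<=` S)%classic.
Proof.
move=> S1 SM SV AS; apply: smallest_sub => //; split; first exact: mem_set.
by move=> x y /set_mem Sx /set_mem Sy; apply/mem_set/SM => //; exact: SV.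
Qed.

Lemma generatedM A x y :
  generated A x -> generated A y -> generated A (x * y).
Proof.
move=> Ax Ay S [clS AS].
by apply/set_mem/(group_closedM clS); apply/mem_set; [exact: Ax|exact: Ay].
Qed.

Lemma generatedV A x : generated A x -> generated A x^-1.
Proof.
by move=> Ax S [clS AS]; apply/set_mem/(group_closedV clS)/mem_set; exact: Ax.
Qed.

Lemma generated1 A : generated A 1.
Proof. by move=> S [[S1 _] _]; exact: set_mem. Qed.

Lemma sub_generated A : (A `<=` generated A)%classic.
Proof. by move=> x Ax S [_]; exact. Qed.

End GeneratedSubgroup.

Section MultiplicativeMaps.
Variables (G K : groupType) (phi : {multiplicative G -> K}).
Local Open Scope group_scope.

Lemma multiplicative1 : phi 1 = 1.
Proof. by apply: (mulIg (phi 1)); rewrite -gmulfM !mul1g. Qed.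

Lemma multiplicativeV x : phi x^-1 = (phi x)^-1.
Proof. by apply: (mulIg (phi x)); rewrite -gmulfM !mulVg multiplicative1. Qed.

Lemma multiplicativeX x k : phi (x ^+ k) = phi x ^+ k.
Proof.
by elim: k => [|k IHk]; rewrite ?expg0 ?multiplicative1// !expgS gmulfM IHk.
Qed.

End MultiplicativeMaps.

Lemma generated_image (G K : groupType) (phi : {multiplicative G -> K})
    (A : set G) :
  (phi @` generated A)%classic = generated (phi @` A)%classic.
Proof.
apply/seteqP; split=> [_ [x Ax <-]|].
  pose S := [set x | generated (phi @` A) (phi x)]%classic.
  suff: (generated A `<=` S)%classic by exact.
  apply: generated_min => [|{Ax}x y ? ?|{Ax}x ?|{Ax}x Ax]; rewrite /S /=.
  - by rewrite multiplicative1; exact: generated1.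
  - by rewrite gmulfM; exact: generatedM.
  - by rewrite multiplicativeV; exact: generatedV.
  - by apply: sub_generated; exists x.
apply: generated_min => [|_ _ [x ? <-] [y ? <-]|_ [x ? <-]|_ [x Ax <-]].
- by exists 1%g; [exact: generated1|rewrite multiplicative1].
- by exists (x * y)%g; [exact: generatedM|rewrite gmulfM].
- by exists x^-1%g; [exact: generatedV|rewrite multiplicativeV].
- by exists x => //; exact: sub_generated.
Qed.

(** * Commuting elements of a free group *)

(** Both sides are powers of commuting words, so they commute, and words of equal
    length that commute for concatenation are equal. *)
Lemma cat_commute_repeat (T : eqType) (u v : seq T) : u ++ v = v ++ u ->
  flatten (nseq (size v) u) = flatten (nseq (size u) v).
Proof.
have repC (s t : seq T) k : s ++ t = t ++ s ->
    flatten (nseq k s) ++ t = t ++ flatten (nseq k s).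
  by move=> st; elim: k => [|k IHk]; rewrite /= ?cats0// -catA IHk !catA st.
move=> /(@repC _ _ (size v))/esym/(@repC _ _ (size u))/esym/eqP.
rewrite eqseq_cat => [/andP[/eqP //]|].
by rewrite !size_flatten /shape !map_nseq !sumn_nseq mulnC.
Qed.

Section FreeGroupCommute.
Variable X : choiceType.
Implicit Types (a b : X * bool) (s t : seq (X * bool)) (x y : freeGroup X).
Local Open Scope group_scope.

Definition free_letter a : freeGroup X := @FreeGroup X [:: a] isT.

Definition free_eval s : freeGroup X := \prod_(a <- s) free_letter a.

Lemma word_free_eval s : word (free_eval s) = word_mul s [::].
Proof.
by rewrite /free_eval; elim: s => [|a s IHs]; rewrite ?big_nil// big_cons /= IHs.
Qed.

Lemma wordK x : free_eval (word x) = x.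
Proof.
by apply: val_inj; rewrite /= word_free_eval word_mulw1//; exact: freeGroupP.
Qed.

Lemma free_eval_cat s t : free_eval (s ++ t) = free_eval s * free_eval t.
Proof. by rewrite /free_eval big_cat. Qed.

Lemma free_eval_repeat s k : free_eval (flatten (nseq k s)) = free_eval s ^+ k.
Proof.
elim: k => [|k IHk]; first by rewrite /free_eval big_nil.
by rewrite /= free_eval_cat IHk expgS.
Qed.

Lemma free_letterV a : free_letter (letter_inv a) = (free_letter a)^-1.
Proof. exact: val_inj. Qed.

Lemma size_free_eval s : (size (word (free_eval s)) <= size s)%N.
Proof.
rewrite word_free_eval; elim: s => //= a s IHs.
case: (word_mul s [::]) IHs => //= b t ts.
by case: ifP => //= _; apply/leqW/ltnW.
Qed.

Lemma free_eval_reduced s : reduced s -> word (free_eval s) = s.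
Proof. by rewrite word_free_eval => /word_mulw1. Qed.

Lemma reduced_cat a s c t :
  reduced (a :: s) -> reduced (c :: t) -> c != letter_inv (last a s) ->
  reduced ((a :: s) ++ (c :: t)).
Proof. by rewrite /reduced /= cat_path /= => -> -> ->. Qed.

(** If [xy] involves no cancellation, then neither does [yx], for the length of
    the common value leaves no room for any; so the words of [x] and [y] commute
    for concatenation, not only in the group. *)
Lemma commute_expg_no_cancel x y a s c t :
  commute x y -> word x = a :: s -> word y = c :: t ->
  c != letter_inv (last a s) -> x ^+ size (word y) = y ^+ size (word x).
Proof.
move=> xy xE yE cs.
have rx := freeGroupP x; have ry := freeGroupP y; rewrite xE in rx; rewrite yE in ry.
have xyE : word (x * y) = (a :: s) ++ (c :: t).
  rewrite -(wordK x) -(wordK y) -free_eval_cat free_eval_reduced ?xE ?yE//.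
  exact: reduced_cat.
have ad : a != letter_inv (last c t).
  apply/negP => /eqP ad.
  have : (size (word (y * x)%g) <= size (belast c t ++ s))%N.
    rewrite -(wordK y) -(wordK x) yE xE lastI -cats1 !free_eval_cat.
    rewrite -[a :: s]cat1s !free_eval_cat ad -!mulgA.
    rewrite [free_eval [:: letter_inv _]]/free_eval big_seq1.
    rewrite [free_eval [:: last _ _]]/free_eval big_seq1.
    by rewrite free_letterV mulVKg -free_eval_cat; exact: size_free_eval.
  rewrite -xy xyE !size_cat size_belast /= addSn addnS [(size t + _)%N]addnC.
  by move/ltnW; rewrite ltnn.
have yxE : word (y * x) = (c :: t) ++ (a :: s).
  rewrite -(wordK x) -(wordK y) -free_eval_cat free_eval_reduced ?xE ?yE//.
  exact: reduced_cat.
have /cat_commute_repeat/(congr1 free_eval) : word x ++ word y = word y ++ word x.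
  by rewrite xE yE -xyE -yxE xy.
by rewrite !free_eval_repeat !wordK.
Qed.

(** A conjugate of minimal length works: if its first and last letters were
    inverse to each other, conjugating by the first one would shorten it. *)
Lemma cyclically_reduced_conj x : x <> 1 -> exists g a s,
  word (x ^ g) = a :: s /\ a != letter_inv (last a s).
Proof.
move=> x1.
have ex : exists k, `[< exists g, size (word (x ^ g)) = k >].
  by exists (size (word (x ^ 1))); apply/asboolP; exists 1.
case: (ex_minnP ex) => k /asboolP[g gk] kmin.
case xgE : (word (x ^ g)) => [|a s].
  by case: x1; apply/eqP; rewrite -(conjg_eq1 x g); apply/eqP/val_inj.
exists g, a, s; split=> //; apply/negP => /eqP al.
have : (k <= size (word (x ^ (g * free_letter a))%g))%N.
  by apply: kmin; apply/asboolP; exists (g * free_letter a).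
case: s xgE al => [|b s] xgE al.
  by move/(congr1 snd): al => /=; case: (a.2).
have E : x ^ g = free_letter a * free_eval (belast b s) * (free_letter a)^-1.
  rewrite -(wordK (x ^ g)) xgE lastI -cats1 -free_letterV al letter_invK /=.
  by rewrite -[X in free_eval X]cat1s !free_eval_cat /free_eval !big_seq1 mulgA.
rewrite conjgM E conjgE -!mulgA mulVg mulg1 mulKg -gk xgE => /leq_trans.
by move/(_ _ (size_free_eval _)); rewrite size_belast /= ltnNge leqnSn.
Qed.

(** Free groups contain no Z^2.  After a conjugation [x] is cyclically reduced,
    so its last letter and the inverse of its first letter are distinct; hence
    the first letter of [y] cancels in at most one of [xy] and [x^-1 y], and
    [commute_expg_no_cancel] applies to [x] or to [x^-1].  The exponent [j] is
    the length of the conjugate of [x], hence positive. *)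
Lemma free_commute_expg x y : commute x y -> x <> 1 ->
  exists i j, (0 < j)%N /\ (x ^+ i = y ^+ j \/ x ^- i = y ^+ j).
Proof.
move=> xy /cyclically_reduced_conj[g [a [s [xgE al]]]].
have xyg : commute (x ^ g) (y ^ g) by rewrite /commute -!conjMg xy.
suff [i [j [j0 E]]] : exists i j, (0 < j)%N /\
    ((x ^ g) ^+ i = (y ^ g) ^+ j \/ (x ^ g) ^- i = (y ^ g) ^+ j).
  exists i, j; split=> //.
  by case: E; rewrite -!conjXg -?conjVg => /conjg_inj; [left|right].
move: (x ^ g) (y ^ g) xyg xgE => {}x {}y {}xy xE.
case yE : (word y) => [|c t].
  exists 0%N, 1%N; split=> //; left; rewrite expg0 expg1.
  by apply: val_inj; rewrite /= yE.
(* The letter [last a s] ends [x]; equality means that [xy] has cancellation. *)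
have [cE|cs] := eqVneq c (letter_inv (last a s)); last first.
  exists (size (word y)), (size (word x)); split; [by rewrite xE|left].
  exact: commute_expg_no_cancel yE cs.
have xVE : word x^-1 =
    letter_inv (last a s) :: map (@letter_inv X) (rev (belast a s)).
  rewrite [LHS](_ : _ = word_inv (word x))// xE /word_inv lastI map_rcons.
  by rewrite rev_rcons map_rev.
exists (size (word y)), (size (word x^-1)); split; [by rewrite xVE|right].
rewrite -expVgn; apply: commute_expg_no_cancel xVE yE _.
  exact/commute_sym/commuteV.
rewrite cE (inj_eq (inv_inj (@letter_invK X))).
case: s al {cE xE} => [//|b s] /=.
rewrite rev_cons map_rcons last_rcons; apply: contra => /eqP ->.
by rewrite letter_invK.
Qed.

End FreeGroupCommute.

(** * Exponent sums and generating sets *)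

Section ExponentSums.
Variable n : nat.
Implicit Types (x y : freeGroup 'I_n).
Local Open Scope ring_scope.

Definition letter_exponents (a : 'I_n * bool) : 'rV[rat]_n :=
  (if a.2 then 1 else -1) *: delta_mx 0 a.1.

(** The abelianization of the free group, with rational coefficients. *)
Definition exponent_sums x : 'rV[rat]_n := \sum_(a <- word x) letter_exponents a.

Lemma exponent_sumsM x y :
  exponent_sums (x * y)%g = exponent_sums x + exponent_sums y.
Proof.
have letterV a : letter_exponents (letter_inv a) = - letter_exponents a.
  by case: a => i []; rewrite /letter_exponents /= -scaleNr ?opprK.
rewrite /exponent_sums /=; elim: (word x) => [|a s IHs] /=.
  by rewrite big_nil add0r.
rewrite big_cons -addrA -{}IHs; case: (word_mul s y) => [|b t] /=.
  by rewrite big_cons.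
case: eqP => [->|_]; last by rewrite big_cons.
by rewrite [in RHS]big_cons letterV addNKr.
Qed.

Lemma exponent_sums1 : exponent_sums 1%g = 0.
Proof. by rewrite /exponent_sums big_nil. Qed.

Lemma exponent_sumsX x k : exponent_sums (x ^+ k)%g = exponent_sums x *+ k.
Proof.
elim: k => [|k IHk]; first by rewrite expg0 exponent_sums1.
by rewrite expgS exponent_sumsM IHk mulrS.
Qed.

Lemma exponent_sumsV x : exponent_sums x^-1%g = - exponent_sums x.
Proof.
by apply/eqP; rewrite -addr_eq0 -exponent_sumsM mulVg exponent_sums1.
Qed.

(** The row space of the matrix of exponent sums of the [g k] contains the
    exponent sums of everything that they generate, so the matrix is invertible;
    a power relation between [g i] and [g j] would make two of its rows
    dependent. *)
Lemma generators_not_commute (g : 'I_n -> freeGroup 'I_n) (i j : 'I_n) :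
  generated (range g) = setT -> i != j -> ~ commute (g i) (g j).
Proof.
move=> gen ij gij.
pose M : 'M[rat]_n := \matrix_k exponent_sums (g k).
have MT x : (exponent_sums x <= M)%MS.
  have : generated (range g) x by rewrite gen.
  pose S := [set x | exponent_sums x <= M]%classic%MS.
  suff: (generated (range g) `<=` S)%classic by exact.
  apply: generated_min => [|{}x y Sx Sy|{}x Sx|_ [k _ <-]]; rewrite /S /=.
  - by rewrite exponent_sums1 sub0mx.
  - by rewrite exponent_sumsM addmx_sub.
  - by rewrite exponent_sumsV eqmx_opp.
  - by rewrite -[X in (X <= _)%MS](rowK (fun k => exponent_sums (g k))) row_sub.
have freeM : row_free M.
  rewrite row_free_unit -row_full_unit -sub1mx; apply/row_subP => k.
  rewrite rowE mulmx1; have := MT (free_letter (k, true)).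
  by rewrite /exponent_sums big_seq1 /letter_exponents scale1r.
have relM (a b : rat) : a *: exponent_sums (g i) = b *: exponent_sums (g j) ->
    a = 0 /\ b = 0.
  move=> ab; pose v : 'rV[rat]_n := a *: delta_mx 0 i - b *: delta_mx 0 j.
  have v0 : v = 0.
    apply: (row_free_inj freeM); rewrite mul0mx mulmxBl -!scalemxAl -!rowE.
    by rewrite !rowK ab subrr.
  split.
    move/matrixP/(_ 0 i): v0; rewrite !mxE !eqxx (negbTE ij) /=.
    by rewrite mulr1 mulr0 subr0.
  move/matrixP/(_ 0 j): v0; rewrite !mxE !eqxx eq_sym (negbTE ij) /=.
  by rewrite mulr1 mulr0 sub0r => /eqP; rewrite oppr_eq0 => /eqP.
have [gi1|gi1] := pselect (g i = 1%g).
  have [] := relM 1 0; last by move/eqP; rewrite oner_eq0.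
  by rewrite gi1 exponent_sums1 scaler0 scale0r.
have [k [l [l0 E]]] := free_commute_expg gij gi1.
suff [a [b [b0 /relM[_ /eqP]]]] : exists a b : rat, b != 0 /\
    a *: exponent_sums (g i) = b *: exponent_sums (g j) by rewrite (negbTE b0).
case: E => /(congr1 exponent_sums); rewrite ?exponent_sumsV !exponent_sumsX => E.
  exists k%:R, l%:R; rewrite pnatr_eq0 -lt0n; split=> //.
  by rewrite !scaler_nat.
exists (- k%:R), l%:R; rewrite pnatr_eq0 -lt0n; split=> //.
by rewrite scaleNr !scaler_nat.
Qed.

End ExponentSums.

(** * One-sided germs of piecewise linear maps *)

Section AffineGerms.
Variable R : realType.
Implicit Types (F h : R -> R) (a b d e s t x y : R).
Local Open Scope classical_set_scope.
Local Open Scope ring_scope.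

(** The set where [k] takes the value [k t] is open and closed in the connected
    interval [a, b]. *)
Lemma locally_constant_itv (T : Type) (k : R -> T) a b :
  (forall t, a < t < b -> \forall y \near t, k y = k t) ->
  forall t u, a < t < b -> a < u < b -> k t = k u.
Proof.
move=> kloc t u tab uab.
pose A := `]a, b[%classic; pose B := (A `&` [set y | k y = k t])%classic.
suff BA : B = A by have [_ ->] : B u by rewrite BA /A /= in_itv.
have Aconn : connected A by apply/connected_intervalP; exact: interval_is_interval.
apply: Aconn.
- by exists t; split => //; rewrite /A /= in_itv.
- exists [set y | k y = k t]°%classic; first exact: open_interior.
  apply/seteqP; split=> y [Ay yt]; split=> //; last exact: interior_subset yt.
  have := kloc y; rewrite /A /= in_itv /= in Ay => /(_ Ay).
  by apply: filterS => z /= ->.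
- exists (~` [set y | k y <> k t]°)%classic.
    by apply: open_closedC; exact: open_interior.
  apply/seteqP; split=> y [Ay yt]; split=> //.
    by move/interior_subset; apply.
  rewrite /A /= in_itv /= in Ay.
  apply: contrapT => yt'; apply: yt; have := kloc y Ay.
  by apply: filterS => z /= ->.
Qed.

(** The local slope [s_] is locally constant, hence a constant [s]; then
    [h t - s * t] is locally constant, hence constant. *)
Lemma locally_affine_itv h a b :
  (forall t, a < t < b ->
     exists s, \forall y \near t, h y = h t + s * (y - t)) ->
  exists c s, forall t, a < t < b -> h t = c + s * t.
Proof.
move=> hloc.
have [s_ hs] : {s_ : R -> R | forall t, a < t < b ->
    \forall y \near t, h y = h t + s_ t * (y - t)}.
  have /choice[s_ ?] : forall t, exists s, a < t < b ->
      \forall y \near t, h y = h t + s * (y - t).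
    move=> t; have [/hloc[s]|] := boolP (a < t < b); first by exists s.
    by exists 0.
  by apply/cid; exists s_.
have [ab|ab] := ltP a b; last first.
  exists 0, 0 => t /andP[ta tb].
  by have := lt_le_trans (lt_trans ta tb) ab; rewrite ltxx.
pose m := (a + b) / 2.
have mab : a < m < b by rewrite /m; apply/andP; split; lra.
have s_loc t : a < t < b -> \forall y \near t, s_ y = s_ t.
  move=> tab; have yab : \forall y \near t, a < y < b.
    have := @near_in_itvoo _ a b t; rewrite in_itv /= => /(_ tab).
    by apply: filterS => y; rewrite in_itv.
  near=> y.
  have yt : \forall z \near y, h z = h t + s_ t * (z - t).
    near: y; pose P := [set z | h z = h t + s_ t * (z - t)]%classic.
    by apply: (near_join (P := P)); exact: hs.
  have yab' : a < y < b by near: y.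
  have := hs y yab'; move/(filterI yt)/nbhs_ballP => -[e /= e0] ze.
  have yE := (ze y (ballxx _ e0)).1.
  have [] := ze (y + e / 2).
    by rewrite /ball /= opprD addNKr normrN gtr0_norm; lra.
  move=> -> zE; have e2 : e / 2 != 0 by rewrite lt0r_neq0//; lra.
  apply/esym/(mulIf e2); move: zE; rewrite yE [y + _]addrC addrK; lra.
have sE := locally_constant_itv s_loc.
have c_loc t : a < t < b ->
    \forall y \near t, h y - s_ m * y = h t - s_ m * t.
  move=> tab; have := hs t tab; apply: filterS => y ->.
  by rewrite (sE t m tab mab); lra.
exists (h m - s_ m * m), (s_ m) => t tab.
by rewrite -(locally_constant_itv c_loc tab mab) subrK.
Unshelve. all: by end_near. Qed.

(** The direction [d] is 1 for the germ on the right of [x] and -1 for the germ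
    on its left, so that both sides are treated at once. *)
Definition affine_germ d F x := exists s e, [/\ 0 < s, 0 < e &
  forall t, 0 <= t <= e -> F (x + d * t) = F x + d * (s * t)].

Lemma locally_affine_germ d F x e : d ^+ 2 = 1 -> 0 < e -> continuous F ->
  {homo F : y z / y < z} ->
  (forall t, 0 < t < e ->
     exists s, \forall y \near x + d * t,
       F y = F (x + d * t) + s * (y - (x + d * t))) ->
  affine_germ d F x.
Proof.
move=> d1 e0 cF iF Floc; pose h t := F (x + d * t).
have dd : d * d = 1 by rewrite -expr2.
have affine_continuous (u v : R) : continuous (fun t : R => u + v * t).
  by move=> t; apply: continuousD; [exact: cst_continuous|exact: mulrl_continuous].
have ch := affine_continuous x d.
have [t /Floc[s Fs]|c [s hE]] := @locally_affine_itv h 0 e.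
  have hs : \forall y \near t,
      F (x + d * y) = F (x + d * t) + s * (x + d * y - (x + d * t)).
    exact: ch t _ Fs.
  exists (s * d); apply: filterS hs => y hy.
  by rewrite /h hy; congr (_ + _); lra.
(* The affine expression is only known on the open interval; continuity gives
   its value at the end point. *)
have hc : c = F x.
  have h0 : h t @[t --> 0^'+] --> h 0.
    apply: cvg_at_right_filter.
    by apply: (@continuous_comp _ _ _ (fun t => x + d * t) F); [apply: ch|apply: cF].
  have h1 : h t @[t --> 0^'+] --> c.
    have cc : (c + s * t) @[t --> 0^'+] --> c.
      have := affine_continuous c s 0; rewrite /continuous_at mulr0 addr0.
      exact: cvg_at_right_filter.
    apply: cvg_trans cc; apply: near_eq_cvg; near=> t; apply/esym/hE.
    by apply/andP; split; near: t; [exact: nbhs_right_gt|exact: nbhs_right_lt].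
  have := cvg_unique _ h1 h0; rewrite /h mulr0 addr0; apply.
  exact: norm_hausdorff.
(* The slope is positive because [F] increases; 1/2 and 1/3 serve to pick two
   points of the interval. *)
have sd0 : 0 < s * d.
  have e2 : 0 < e / 2 < e by apply/andP; split; lra.
  have e3 : 0 < e / 3 < e by apply/andP; split; lra.
  have := hE _ e2; have := hE _ e3; rewrite /h => E3 E2.
  have dE : d = 1 \/ d = -1.
    by have /eqP := d1; rewrite sqrf_eq1 => /orP[] /eqP; [left|right].
  case: dE => dE; rewrite dE in E2 E3 *.
    have : F (x + 1 * (e / 3)) < F (x + 1 * (e / 2)) by apply: iF; lra.
    rewrite E2 E3 mulr1 => sE.
    have : 0 < s * (e / 6) by lra.
    by rewrite pmulr_lgt0//; lra.
  have : F (x + -1 * (e / 2)) < F (x + -1 * (e / 3)) by apply: iF; lra.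
  rewrite E2 E3 mulrN1 => sE.
  have : 0 < (- s) * (e / 6) by lra.
  by rewrite pmulr_lgt0//; lra.
exists (s * d), (e / 2); split=> [//||t /andP[t0 te]]; first by lra.
have -> : d * (s * d * t) = s * t by rewrite [s * d]mulrC -mulrA mulrA dd mul1r.
have [->|tn0] := eqVneq t 0; first by rewrite !mulr0 !addr0.
rewrite -hc; apply: hE; rewrite lt_neqAle eq_sym tn0 t0 /=; lra.
Unshelve. all: by end_near. Qed.

(** The points of R over one point of the circle are at distance at least 1
    from each other, so at most one of them is within 1/2 of [x]. *)
Lemma finite_circle_isolated (B : set (circle R)) x : finite_set B ->
  exists2 e, 0 < e & forall y, 0 < `|y - x| < e -> ~ B (circle_pi y).
Proof.
move=> /finite_seqP[r ->].
elim: r => [|p r [e e0 IHr]]; first by exists 1.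
suff [e' e'0 pe] : exists2 e', 0 < e' &
    forall y, 0 < `|y - x| < e' -> circle_pi y <> p.
  exists (Num.min e e'); first by rewrite lt_min e0.
  move=> y /andP[y0]; rewrite lt_min => /andP[ye ye'] /=.
  rewrite inE => /orP[/eqP|yr]; first by apply: pe; rewrite y0.
  by apply: (IHr y) => //; rewrite y0.
have int_small z : z \is a Num.int -> `|z| < 1 -> z = 0 :> R.
  case/intrP => k ->; rewrite -intr_norm ltrz1 => k1.
  suff -> : k = 0 by [].
  by case: k k1 => [[|k]|k].
have [[y1 [y1x y1p]]|none] :=
    pselect (exists y1, 0 < `|y1 - x| < 2^-1 /\ circle_pi y1 = p).
  exists `|y1 - x|; first by case/andP: y1x.
  move=> y /andP[y0 yx] yp.
  have /circle_piP/int_small : circle_pi y = circle_pi y1 by rewrite yp.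
  move: y1x => /andP[_ y1x] yy1; suff E : y = y1 by rewrite E ltxx in yx.
  apply/eqP; rewrite -subr_eq0; apply/eqP/yy1.
  have -> : y - y1 = (y - x) - (y1 - x) by lra.
  by apply: le_lt_trans (ler_normB _ _) _; lra.
by exists 2^-1 => [|y yx yp]; [lra|apply: none; exists y].
Qed.

Lemma dyadic_piecewise_linear_germ d F x : d ^+ 2 = 1 -> continuous F ->
  {homo F : y z / y < z} -> dyadic_piecewise_linear F -> affine_germ d F x.
Proof.
move=> d1 cF iF [B [Bfin _ FB]].
have [e e0 eB] := finite_circle_isolated x Bfin.
apply: (locally_affine_germ d1 e0 cF iF) => t /andP[t0 te].
have dn : `|d| = 1.
  by apply/eqP; rewrite -(@eqrXn2 _ 2)// real_normK ?num_real// d1 expr1n.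
have [|k Fk] := FB (x + d * t); last by exists (2 ^ k).
by apply: eB; rewrite addrC addKr normrM dn mul1r gtr0_norm// t0.
Qed.

(** Germs at a fixed point are determined by their slopes, which multiply.  The
    bound on [t] keeps both [t] and its first image in the intervals where the
    two germs are affine. *)
Lemma affine_germ_commute d F h x : d ^+ 2 = 1 -> F x = x -> h x = x ->
  affine_germ d F x -> affine_germ d h x ->
  exists2 e, 0 < e & forall t, 0 <= t <= e -> F (h (x + d * t)) = h (F (x + d * t)).
Proof.
move=> d1 Fx hx [s [e [s0 e0 FE]]] [r [c [r0 c0 hE]]].
rewrite Fx in FE; rewrite hx in hE.
exists (Num.min (Num.min e c) (Num.min (e / r) (c / s))).
  by rewrite !lt_min e0 c0 !divr_gt0.
move=> t /andP[t0]; rewrite !le_min => /andP[/andP[te tc] /andP[ter tcs]].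
rewrite hE ?t0// FE; last first.
  by apply/andP; split; [exact: mulr_ge0 (ltW r0) t0|rewrite mulrC -ler_pdivlMr].
rewrite FE ?t0// hE; last first.
  by apply/andP; split; [exact: mulr_ge0 (ltW s0) t0|rewrite mulrC -ler_pdivlMr].
by rewrite [s * _]mulrCA.
Qed.

End AffineGerms.

(** * The Brin-Squier theorem *)

(** The subgroup [S] generated by [f] and [g] acts faithfully on [[a, b]] by
    increasing maps with affine one-sided germs, and it contains no Z^2. *)
Section BrinSquier.
Variables (R : realType) (G : groupType) (f g : G).
Variables (rho : G -> R -> R) (a b : R).
Implicit Types (u v w k : G) (x y s t z d : R).
Local Open Scope ring_scope.

Let S : set G := generated [set f; g]%classic.

Hypothesis ab : a < b.
Hypothesis rhoM : forall u v x, S u -> S v -> rho (u * v)%g x = rho u (rho v x).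
Hypothesis rho_lt : forall u, S u -> {homo rho u : x y / x < y}.
Hypothesis rho_germ : forall u d x, S u -> d ^+ 2 = 1 -> affine_germ d (rho u) x.
Hypothesis rho_a : forall u, S u -> rho u a = a.
Hypothesis rho_b : forall u, S u -> rho u b = b.
Hypothesis rho_faithful : forall u, S u ->
  (forall x, a <= x <= b -> rho u x = x) -> u = 1%g.
Hypothesis commute_power : forall u v, S u -> S v -> commute u v -> u <> 1%g ->
  exists i j, (0 < j)%N /\ (u ^+ i = v ^+ j \/ u ^- i = v ^+ j)%g.

Let Sf : S f. Proof. by apply: sub_generated; left. Qed.
Let Sg : S g. Proof. by apply: sub_generated; right. Qed.
Let S1 : S 1%g. Proof. exact: generated1. Qed.
Let SM u v : S u -> S v -> S (u * v)%g. Proof. exact: generatedM. Qed.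
Let SV u : S u -> S u^-1%g. Proof. exact: generatedV. Qed.
Let SJ u v : S u -> S v -> S (u ^ v)%g.
Proof. by move=> Su Sv; rewrite conjgE; do ?apply: SM => //; exact: SV. Qed.
Let SR u v : S u -> S v -> S [~ u, v]%g.
Proof. by move=> Su Sv; rewrite commgEl; apply: SM; [exact: SV|exact: SJ]. Qed.
Let SX u n : S u -> S (u ^+ n)%g.
Proof.
by move=> Su; elim: n => [|n IHn]; rewrite ?expg0// expgS; exact: SM.
Qed.

Let rho_le u : S u -> {mono rho u : x y / x <= y}.
Proof. by move=> Su; apply: le_mono => x y; exact: rho_lt. Qed.

Let rho_inj u : S u -> injective (rho u).
Proof. by move=> Su; exact: inc_inj (rho_le Su). Qed.

Let rho1 x : rho 1%g x = x.
Proof. by apply: (rho_inj S1); rewrite -rhoM// mulg1. Qed.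

Let rhoVK u : S u -> cancel (rho u) (rho u^-1%g).
Proof. by move=> Su x; rewrite -rhoM ?mulVg//; exact: SV. Qed.

Let rhoK u : S u -> cancel (rho u^-1%g) (rho u).
Proof. by move=> Su x; rewrite -rhoM ?mulgV//; exact: SV. Qed.

Let rho_fixV u x : S u -> rho u x = x -> rho u^-1%g x = x.
Proof. by move=> Su ux; rewrite -{1}ux rhoVK. Qed.

Let rho_fixX u x n : S u -> rho u x = x -> rho (u ^+ n)%g x = x.
Proof.
move=> Su ux; elim: n => [|n IHn]; first by rewrite expg0 rho1.
by rewrite expgS rhoM ?IHn//; exact: SX.
Qed.

Let fixed_generated x : rho f x = x -> rho g x = x ->
  forall u, S u -> rho u x = x.
Proof.
move=> fx gx; pose T := [set u | S u /\ rho u x = x]%classic.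
suff ST : (S `<=` T)%classic by move=> u /ST[].
apply: generated_min => [|u v [Su ux] [Sv vx]|u [Su ux]|u [->|->]]; split=> //.
- exact: SM.
- by rewrite rhoM// vx.
- exact: SV.
- exact: rho_fixV.
Qed.

Let commutator_fixes u v x : S u -> S v ->
  rho u (rho v x) = rho v (rho u x) -> rho [~ u, v]%g x = x.
Proof.
move=> Su Sv uvx; rewrite commgEl conjgE.
have SVu := SV Su; have SVv := SV Sv.
rewrite !rhoM//; first by rewrite uvx rhoVK// rhoVK.
- exact: SM.
- by apply: SM => //; exact: SM.
Qed.

Let rho_expg_move u x n : S u -> (0 < n)%N -> rho u x <> x ->
  rho (u ^+ n)%g x <> x.
Proof.
move=> Su; case: n => // n _ /eqP; rewrite neq_lt => /orP[] ux; apply/eqP.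
  rewrite lt_eqF//; elim: n => [|n IHn]; first by rewrite expg1.
  rewrite expgS rhoM//; last exact: SX.
  by apply: lt_trans ux; exact: rho_lt.
rewrite gt_eqF//; elim: n => [|n IHn]; first by rewrite expg1.
rewrite expgS rhoM//; last exact: SX.
by apply: lt_trans ux _; exact: rho_lt.
Qed.

(* By [fixed_generated], the common fixed points of [f] and [g] are those of
   [S]. *)
Let common z := rho f z = z /\ rho g z = z.

(** At a fixed point of the whole group the germs of [u] and [v] commute. *)
Let commutator_germ u v z d : S u -> S v -> common z -> d ^+ 2 = 1 ->
  exists2 e, 0 < e & forall t, 0 <= t <= e -> rho [~ u, v]%g (z + d * t) = z + d * t.
Proof.
move=> Su Sv [fz gz] d1; have fixz := fixed_generated fz gz.
have [e e0 uv] := affine_germ_commute d1 (fixz u Su) (fixz v Sv)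
  (rho_germ z Su d1) (rho_germ z Sv d1).
by exists e => // t te; apply: commutator_fixes => //; exact: uv.
Qed.

(** The quantity pushed to the right: [t] is good when some nontrivial commutator
    acts as the identity up to [t].  By faithfulness no good [t] reaches [b]. *)
Let good t := a <= t /\ exists u v, [/\ S u, S v, [~ u, v]%g <> 1%g &
  forall x, a <= x <= t -> rho [~ u, v]%g x = x].

Let good_lt t : good t -> t < b.
Proof.
move=> [_ [u [v [Su Sv uv1 uvt]]]]; rewrite ltNge; apply/negP => bt.
apply: uv1; apply: rho_faithful => [|x /andP[ax xb]]; first exact: SR.
by apply: uvt; rewrite ax (le_trans xb).
Qed.

Let good_extend s : common s -> good s -> exists2 s', s < s' & good s'.
Proof.
move=> cs [as_ [u [v [Su Sv uv1 uvs]]]].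
have [e e0 uve] := commutator_germ Su Sv cs (expr1n _ 2).
exists (s + e); first lra.
split; first lra.
exists u, v; split=> // x /andP[ax xe].
have [xs|sx] := leP x s; first by apply: uvs; rewrite ax.
have -> : x = s + 1 * (x - s) by lra.
by apply: uve; apply/andP; split; lra.
Qed.

(** The point [s] is the supremum of the orbit of [t].  An element [k] carrying
    [t] beyond the support of the commutator [w] in [[a, s]] makes [w] commute
    with its conjugate [w'] by [k] there; so either [[~ w, w']] is the new
    nontrivial commutator, or a positive power of [w] is a power of [w'], and as
    their supports in [[a, s]] are disjoint, [w] is the identity up to [s]. *)
Let good_push t : good t -> exists s, [/\ t <= s, common s & good s].
Proof.
move=> gt; have tb := good_lt gt; case: gt => at_ [u [v [Su Sv w1 wt]]].
have Sw := SR Su Sv; set w := [~ u, v]%g in w1 wt Sw.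
pose O := [set rho k t | k in S]%classic.
have supO : has_sup O.
  split; first by exists t, 1%g => //; exact: rho1.
  by exists b => _ [k Sk <-]; rewrite -(rho_b Sk) rho_le// ltW.
pose s := sup O.
have sub k : S k -> rho k t <= s.
  by move=> Sk; apply: sup_upper_bound => //; exists k.
have ts : t <= s by rewrite -[t]rho1; exact: sub.
(* Each [k] permutes the orbit of [t], whose supremum it can neither raise nor
   lower. *)
have s_le k : S k -> s <= rho k s.
  move=> Sk; apply: ge_sup; first by case: supO.
  move=> _ [l Sl <-]; have SVk := SV Sk.
  have -> : rho l t = rho k (rho (k^-1 * l)%g t) by rewrite rhoM// rhoK.
  by rewrite rho_le// sub//; exact: SM.
have s_fix k : S k -> rho k s = s.
  move=> Sk; apply/eqP; rewrite eq_le s_le// andbT.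
  by rewrite -[leRHS](rhoK Sk) rho_le// s_le//; exact: SV.
have cs : common s by split; exact: s_fix.
have d1 : (-1 : R) ^+ 2 = 1 by rewrite sqrrN expr1n.
have [e e0 we] := commutator_germ Su Sv cs d1; rewrite -/w in we.
(* On [[a, s]], only points strictly between [t] and [s - e] are moved by [w],
   and only points strictly between [rho k t] and [s] by [w']. *)
have wleft x : s - e <= x <= s -> rho w x = x.
  move=> /andP[xe xs]; have -> : x = s + -1 * (s - x) by lra.
  by apply: we; apply/andP; split; lra.
have as_ : a <= s by exact: le_trans ts.
have [_ [k Sk <-] kt] : exists2 y, O y & s - e < y by exact: sup_adherent.
pose w' := (w ^ k^-1)%g; have Sw' : S w' by apply: SJ => //; exact: SV.
have w'E x : rho w' x = rho k (rho w (rho k^-1%g x)).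
  by rewrite /w' conjgE invgK !rhoM//; do ?[exact: SV|apply: SM => //].
have w'left x : a <= x <= rho k t -> rho w' x = x.
  move=> /andP[ax xk]; rewrite w'E wt ?rhoK//.
  rewrite -(rho_le Sk) -[X in _ && X](rho_le Sk) rhoK// rho_a// ax //.
have ww' x : a <= x <= s -> rho w (rho w' x) = rho w' (rho w x).
  move=> /andP[ax xs]; have [xk|kx] := leP x (rho k t).
    rewrite [rho w' x]w'left ?ax//.
    have [xe|ex] := leP x (s - e); last first.
      by rewrite wleft ?w'left ?ax// xs ltW.
    rewrite w'left// -{1}(rho_a Sw) rho_le// ax /=.
    apply: ltW; apply: le_lt_trans kt.
    have wse : rho w (s - e) = s - e.
      by apply: wleft; apply/andP; split; lra.
    by rewrite -[leRHS]wse rho_le.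
  have kx' : s - e <= x by apply/ltW; exact: lt_trans kx.
  rewrite [rho w x]wleft ?kx'// wleft//.
  rewrite -[X in _ && (_ <= X)](s_fix _ Sw') rho_le// xs andbT.
  apply: ltW; apply: lt_le_trans kt _.
  have w'k : rho w' (rho k t) = rho k t.
    by apply: w'left; rewrite lexx andbT -{1}(rho_a Sk) rho_le.
  by rewrite -w'k rho_le// ltW.
exists s; split=> //; split=> //.
have [/eqP/commgP ww'C|ww'1] := pselect ([~ w, w']%g = 1%g); last first.
  exists w, w'; split=> // x axs.
  by apply: commutator_fixes => //; exact: ww'.
exists u, v; split=> // x /andP[ax xs].
apply: contrapT => wx.
have xe : x < s - e.
  by rewrite ltNge; apply/negP => ex; apply: wx; apply: wleft; rewrite ex.
have w'x : rho w' x = x.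
  by apply: w'left; rewrite ax /= ltW// (lt_trans xe).
(* Here [x] is fixed by [w'] but moved by [w], hence moved by all positive
   powers of [w]. *)
have w'1 : w' <> 1%g by move/eqP; rewrite conjg_eq1 => /eqP.
have [i [j [j0 E]]] := commute_power Sw' Sw (commute_sym ww'C) w'1.
apply: (rho_expg_move Sw j0 wx).
by case: E => <-; [|apply: rho_fixV]; do ?[exact: SX|exact: rho_fixX].
Qed.

(** Let [T] be the supremum of the good points, starting from [a], which is good
    when [f] and [g] do not commute.  A good point can be pushed to a good common
    fixed point below [T] and extended beyond it, so common fixed points
    accumulate at [T] from the left.  As the germs of [f] and [g] on the left of
    [T] are affine, both are the identity there, and so is all of [S]; hence [T]
    is a good common fixed point, and can itself be extended. *)
Theorem brin_squier : commute f g.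
Proof.
apply: contrapT => fg.
have good_a : good a.
  split=> //; exists f, g; split=> //; first by move/eqP/commgP.
  move=> x; rewrite -eq_le => /eqP <-; apply: rho_a; exact: SR.
pose E := [set t | good t]%classic.
have supE : has_sup E.
  by split; [exists a|exists b => t /good_lt/ltW].
pose T := sup E.
have leT t : good t -> t <= T by move=> gt; apply: sup_upper_bound.
have step t : good t -> exists s, [/\ t <= s, s < T, common s & good s].
  move=> /good_push[s [ts cs gs]]; exists s; split=> //.
  by have [s' ss' /leT] := good_extend cs gs; exact: lt_le_trans.
have d1 : (-1 : R) ^+ 2 = 1 by rewrite sqrrN expr1n.
have [r [e1 [r0 e10 fE]]] := rho_germ T Sf d1.
have [q [e2 [q0 e20 gE]]] := rho_germ T Sg d1.
pose e := Num.min e1 e2.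
have e0 : 0 < e by rewrite lt_min e10.
have [t1 /step[s1 [ts1 s1T cs1 gs1]] et1] : exists2 t, E t & T - e < t.
  exact: sup_adherent.
have [s1' ss1' gs1'] := good_extend cs1 gs1.
have [s2 [ss2 s2T cs2 _]] := step _ gs1'.
have s12 : s1 < s2 by exact: lt_le_trans ss2.
(* An affine map with two fixed points is the identity. *)
have affine_id (F : R -> R) c p : e <= c ->
    (forall t, 0 <= t <= c -> F (T + -1 * t) = F T + -1 * (p * t)) ->
    F s1 = s1 -> F s2 = s2 -> forall x, s1 <= x <= T -> F x = x.
  move=> ec FE F1 F2 x /andP[s1x xT].
  have toT y : s1 <= y <= T -> F y = F T + p * (y - T).
    move=> /andP[s1y yT]; have -> : y = T + -1 * (T - y) by lra.
    by rewrite FE; [lra|apply/andP; split; lra].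
  have := toT s1; have := toT s2; rewrite F1 F2 (toT x) ?s1x//.
  move=> /(_ ltac:(apply/andP; split; lra)) E2 /(_ ltac:(apply/andP; split; lra)) E1.
  have p1 : p = 1.
    have : (p - 1) * (s2 - s1) = 0 by lra.
    by move/eqP; rewrite mulf_eq0 => /orP[] /eqP; lra.
  by rewrite p1 in E1 *; lra.
have f_id : forall x, s1 <= x <= T -> rho f x = x.
  apply: (affine_id _ e1 r) => //;
    [by rewrite ge_min lexx|by case: cs1|by case: cs2].
have g_id : forall x, s1 <= x <= T -> rho g x = x.
  apply: (affine_id _ e2 q) => //;
    [by rewrite ge_min lexx orbT|by case: cs1|by case: cs2].
have s1TT : s1 <= T <= T by rewrite lexx andbT ltW.
have cT : common T by split; [exact: f_id|exact: g_id].
have gT : good T.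
  case: gs1 => as1 [u [v [Su Sv uv1 uvs]]]; split; first exact: leT.
  exists u, v; split=> // x /andP[ax xT].
  have [xs|sx] := leP x s1; first by apply: uvs; rewrite ax.
  apply: fixed_generated; [apply: f_id|apply: g_id|exact: SR]; by rewrite xT ltW.
by have [T' TT' /leT] := good_extend cT gT; rewrite leNgt TT'.
Qed.

End BrinSquier.

(** * Lifts fixing a base point *)

Section BasedLifts.
Variable R : realType.
Implicit Types (g h : circle R -> circle R) (F H : R -> R) (x z : R).
Local Open Scope classical_set_scope.
Local Open Scope ring_scope.

Lemma lift_addz F x (m : int) : (forall x, F (x + 1) = F x + 1) ->
  F (x + m%:~R) = F x + m%:~R.
Proof.
move=> F1; case: m => k; first exact: lift_int.
by rewrite NegzE mulrNz -[X in F X + _](subrK k.+1%:R x) (lift_int _ _ F1) addrK.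
Qed.

Definition based_lift z g F := increasing_lift g F /\ F z = z.

(** Two lifts differ by an integer at each point, and both values at [x] lie in
    the same interval [[z + m, z + m + 1[] as [x], whose end points are fixed. *)
Lemma based_lift_uniq z g F H :
  based_lift z g F -> based_lift z g H -> F = H.
Proof.
move=> [[_ iF F1 gF] Fz] [[_ iH H1 gH] Hz]; apply/funext => x.
have bound K : {homo K : x y / x < y} -> (forall x, K (x + 1) = K x + 1) ->
    K z = z -> z + (Num.floor (x - z))%:~R <= K x < z + (Num.floor (x - z))%:~R + 1.
  move=> iK K1 Kz; have mK : {mono K : x y / x <= y} by apply: le_mono.
  rewrite -{1 3}Kz -!(lift_addz _ _ K1) -K1 mK (leW_mono mK).
  have /andP[] := floor_itv (x - z).
  by rewrite intrD => ? ?; apply/andP; split; lra.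
have /circle_piP : circle_pi (F x) = circle_pi (H x) by rewrite -gF gH.
case/intrP => k E; have := bound F iF F1 Fz; have := bound H iH H1 Hz.
move=> /andP[Hl Hr] /andP[Fl Fr].
have : `|k%:~R| < 1 :> R by rewrite -E ltr_norml; apply/andP; split; lra.
rewrite -intr_norm ltrz1 => k1.
have k0 : k = 0 by case: (k) k1 => [[|l]|l].
by apply/eqP; rewrite -subr_eq0 E k0.
Qed.

Lemma based_lift_comp z g h F H :
  based_lift z g F -> based_lift z h H -> based_lift z (g \o h) (F \o H).
Proof.
move=> [[cF iF F1 gF] Fz] [[cH iH H1 hH] Hz]; split; last by rewrite /= Hz.
split=> [x|x y /iH/iF//|x|x] /=; last by rewrite hH gF.
  by apply: continuous_comp; [exact: cH|exact: cF].
by rewrite H1 F1.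
Qed.

Lemma based_lift_exists z (g : thompsonT R) : g (circle_pi z) = circle_pi z ->
  exists F, based_lift z g F /\ dyadic_piecewise_linear F.
Proof.
move=> gz; have [_ _ [F [cF iF F1 gF] [B [Bfin BD FB]]]] := thompsonTP g.
have /circle_piP/intrP[m Fz] : circle_pi (F z) = circle_pi z by rewrite -gF.
exists (fun x => F x - m%:~R); split; last first.
  exists B; split=> // x /FB[k]; exists k.
  near=> y; have -> : F y = F x + 2 ^ k * (y - x) by near: y.
  by rewrite addrAC.
split; last by rewrite -Fz; lra.
split=> [x|x y xy|x|x].
- by apply: cvgB; [exact: cF|exact: cvg_cst].
- by rewrite ltrD2r iF.
- by rewrite F1 addrAC.
- rewrite gF; apply/circle_piP; rewrite opprD addNKr opprK.
  exact: intr_int.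
Unshelve. all: by end_near. Qed.

End BasedLifts.

(** Lifts fixing a point [z] over [p] are unique, so they compose as the elements
    of the stabilizer of [p] do, and [brin_squier] applies on [[z, z + 1]]. *)
Lemma commute_of_common_fixpoint (R : realType) (f g : thompsonT R)
    (p : circle R) :
  (forall u v, generated [set f; g]%classic u ->
     generated [set f; g]%classic v -> commute u v -> u <> 1%g ->
     exists i j, (0 < j)%N /\ (u ^+ i = v ^+ j \/ u ^- i = v ^+ j)%g) ->
  f p = p -> g p = p -> commute f g.
Proof.
move=> pow fp gp; have [z zp] := circle_pi_surj p; rewrite -{}zp in fp gp.
set S := generated _ in pow.
have fixS u : S u -> u (circle_pi z) = circle_pi z.
  pose Q := [set u : thompsonT R | u (circle_pi z) = circle_pi z]%classic.
  suff: (S `<=` Q)%classic by exact.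
  apply: generated_min => [//|{}u v uz vz|{}u uz|_ [->|->]//]; rewrite /Q /=.
    by rewrite vz.
  by rewrite -{1}uz (thompsonT_invK u).1.
have [rho rhoP] : exists rho : thompsonT R -> R -> R, forall u, S u ->
    based_lift z u (rho u) /\ dyadic_piecewise_linear (rho u).
  have /choice[rho ?] : forall u : thompsonT R, exists F, S u ->
      based_lift z u F /\ dyadic_piecewise_linear F.
    move=> u; have [/fixS/based_lift_exists[F ?]|Su] := pselect (S u).
      by exists F.
    by exists id.
  by exists rho.
have z1 : (z < z + 1)%R by rewrite ltrDl.
apply: (@brin_squier R _ f g rho z (z + 1)%R) => //.
- move=> u v x Su Sv; rewrite -[RHS]/((rho u \o rho v) x).
  congr (_ x); apply: (@based_lift_uniq _ z (u * v)%g).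
    by case: (rhoP (u * v)%g) => //; exact: generatedM.
  by apply: (based_lift_comp (g := u) (h := v)); [case: (rhoP u)|case: (rhoP v)].
- by move=> u Su; case: (rhoP u Su) => -[[]].
- move=> u d x Su d1; case: (rhoP u Su) => -[[cu iu _ _] _] plu.
  exact: dyadic_piecewise_linear_germ.
- by move=> u Su; case: (rhoP u Su) => -[].
- by move=> u Su; case: (rhoP u Su) => -[[_ _ -> _] ->].
- move=> u Su uid; apply: thompsonT_ext => q; rewrite thompsonT_oneE.
  have [x <-] := circle_pi_surj q.
  pose m := Num.floor (x - z).
  have -> : circle_pi x = circle_pi (x - m%:~R)%R.
    by apply/circle_piP; rewrite opprB addrC subrK; exact: intr_int.
  case: (rhoP u Su) => -[[_ _ _ ->] _] _; congr circle_pi; apply: uid.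
  have /andP[] := floor_itv (x - z)%R.
  by rewrite -/m intrD => ? ?; apply/andP; split; lra.
Qed.

(** * Generators of free subgroups and disjoint supports *)

Lemma disjoint_supp_commute (R : realType) (f g : thompsonT R) :
  (forall p, f p = p \/ g p = p) -> commute f g.
Proof.
move=> fg; apply: thompsonT_ext => p; rewrite !thompsonT_mulE.
have injT (u : thompsonT R) : injective u := can_inj (thompsonT_invK u).1.
have [fp|gp] := fg p.
  have [fgp|ggp] := fg (g p); first by rewrite fgp fp.
  by have := injT _ _ _ ggp => gp; rewrite gp fp gp.
have [ffp|gfp] := fg (f p); last by rewrite gfp gp.
by have := injT _ _ _ ffp => fp; rewrite fp gp fp.
Qed.

(** The isomorphism with the free group transports [generators_not_commute] and
    [free_commute_expg]; the given generators need not correspond to its standard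
    basis. *)
Lemma free_generators (G : groupType) (n : nat) (x : 'I_n -> G) :
  free_of_rank n (generated (range x)) ->
  (forall i j, i != j -> ~ commute (x i) (x j)) /\
  (forall u v, generated (range x) u -> generated (range x) v ->
     commute u v -> u <> 1%g ->
     exists i j, (0 < j)%N /\ (u ^+ i = v ^+ j \/ u ^- i = v ^+ j)%g).
Proof.
move=> [phi [phi_inj phiE]]; split=> [i j ij xij|u v].
  have /choice[y yE] : forall k, exists y, phi y = x k.
    move=> k; have : generated (range x) (x k) by apply: sub_generated; exists k.
    by rewrite -phiE => -[y _ <-]; exists y.
  apply: (@generators_not_commute n y i j) => //.
    apply/seteqP; split=> // w _.
    have rangeE : (phi @` range y = range x)%classic.
      by rewrite image_comp; congr (image _ _); apply/funext => k /=; exact: yE.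
    have : range phi (phi w) by exists w.
    by rewrite phiE -rangeE -generated_image => -[w' ? /phi_inj <-].
  by apply: phi_inj; rewrite !gmulfM !yE.
rewrite -phiE => -[{}u _ <-] [{}v _ <-] uv u1.
have uv' : commute u v by apply: phi_inj; rewrite !gmulfM.
have u1' : u <> 1%g by move=> uE; apply: u1; rewrite uE multiplicative1.
have [i [j [j0 E]]] := free_commute_expg uv' u1'.
exists i, j; split=> //; case: E => E; [left|right].
  by rewrite -!multiplicativeX E.
by rewrite -!multiplicativeX -multiplicativeV E.
Qed.

Theorem corollary5 (R : realType) (H : set (thompsonT R)) (h1 h2 : thompsonT R)
    (Hh1 : H h1) (Hh2 : H h2)
    (Hdisj : (supp h1 `&` supp h2 = set0)%classic)
    (n : nat) (hn : (2 <= n)%N) :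
  ~ exists c : 'I_n -> thompsonT R,
      forall h : thompsonT R, H h ->
        free_of_rank n
          (generated [set (c i * h * (c i)^-1)%g | i in [set: 'I_n]]%classic).
Proof.
move=> [c freeH].
have [nc1 pow1] := free_generators (freeH h1 Hh1).
have [nc2 _] := free_generators (freeH h2 Hh2).
pose i0 := Ordinal (ltnW hn); pose i1 := Ordinal hn.
have i01 : i0 != i1 by [].
have conj_fix h i p : (c i * h * (c i)^-1)%g p = p <->
    h ((c i)^-1%g p) = (c i)^-1%g p.
  rewrite !thompsonT_mulE; split=> [E|->]; last exact: (thompsonT_invK (c i)).2.
  by rewrite -{2}E (thompsonT_invK (c i)).1.
have no_fix p : ~ ((c i0 * h1 * (c i0)^-1)%g p = p /\
                   (c i1 * h1 * (c i1)^-1)%g p = p).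
  move=> [p0 p1]; apply: (nc1 i0 i1 i01).
  apply: commute_of_common_fixpoint p0 p1 => u v.
  have sub : (generated [set c i0 * h1 * (c i0)^-1; c i1 * h1 * (c i1)^-1]%g `<=`
      generated (range (fun i => c i * h1 * (c i)^-1)%g))%classic.
    apply: generated_min.
    - exact: generated1.
    - by move=> x y; exact: generatedM.
    - by move=> x; exact: generatedV.
    - by move=> x [->|->]; apply: sub_generated; [exists i0|exists i1].
  by move=> /sub Su /sub Sv; exact: pow1.
apply: (nc2 i0 i1 i01); apply: disjoint_supp_commute => p.
have h12 q : h1 q = q \/ h2 q = q.
  apply: contrapT => /not_orP[q1 q2].
  by have : (supp h1 `&` supp h2)%classic q by []; rewrite Hdisj.
have [p0|p0] := pselect ((c i0 * h2 * (c i0)^-1)%g p = p); first by left.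
have [p1|p1] := pselect ((c i1 * h2 * (c i1)^-1)%g p = p); first by right.
case: (no_fix p); split; apply/conj_fix.
  by have [//|/conj_fix] := h12 ((c i0)^-1%g p).
by have [//|/conj_fix] := h12 ((c i1)^-1%g p).
Qed.
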